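(* Let $m\ge 1$ be an integer. (1) For all $p,q\in\mathcal P_{2m}$, $$\mathbf Q_m(p\boxtimes_{2m}q)=\mathbf Q_m(p)\boxtimes_m\mathbf Q_m(q)\boxtimes_m\mathcal H_m\left[\begin{smallmatrix}-\frac1{2m}\\ 1-\frac1{2m}\end{smallmatrix}\right].$$ (2) Equivalently, in terms of the degree doubling operation: for all $p,q\in\mathcal P_m$, $$\mathbf S_m(p\boxtimes_m q)=\mathbf S_m(p)\boxtimes_{2m}\mathbf S_m(q)\boxtimes_{2m}\mathbf S_m\left(\mathcal H_m\left[\begin{smallmatrix}1-\frac1{2m},\ 1-\frac1{2m}\\ -\frac1{2m},\ -\frac1{2m}\end{smallmatrix}\right]\right).$$
   Context: $\mathcal P_n$ is the set of monic polynomials of degree $n$ over $\mathbb C$. For $p\in\mathcal P_n$ the coefficients $\mathsf e_k(p)$ are defined by $p(x)=\sum_{k=0}^n x^{n-k}(-1)^k\mathsf e_k(p)$. The falling factorial is $(a)^{\underline k}=a(a-1)\cdots(a-k+1)$. The finite free multiplicative convolution of $p,q\in\mathcal P_n$ is the polynomial $p\boxtimes_n q\in\mathcal P_n$ with $\mathsf e_k(p\boxtimes_n q)=\binom nk^{-1}\mathsf e_k(p)\mathsf e_k(q)$ for $0\le k\le n$. The degree doubling operation $\mathbf S_m:\mathcal P_m\to\mathcal P_{2m}$ is $\mathbf S_m(p)(x)=p(x^2)$. The map $\mathbf Q_m:\mathcal P_{2m}\to\mathcal P_m$ is defined by $\mathsf e_k(\mathbf Q_m(p))=(-1)^k\mathsf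 e_{2k}(p)$ for $0\le k\le m$. Hypergeometric polynomials: for real $b_1,\dots,b_j$ and real $a_1,\dots,a_i\notin\{0,\frac1n,\dots,\frac{n-1}n\}$, $\mathcal H_n\left[\begin{smallmatrix}b_1,\dots,b_j\\ a_1,\dots,a_i\end{smallmatrix}\right]\in\mathcal P_n$ is the monic polynomial with $\mathsf e_k=\binom nk\frac{\prod_{t=1}^j(nb_t)^{\underline k}}{\prod_{s=1}^i(na_s)^{\underline k}}$ for $0\le k\le n$. *)

(* Defs.v *)
(* MathComp; the complex numbers are R[i] for R : realType. *)
From HB Require Import structures.
From mathcomp Require Import all_boot all_order all_algebra.
From mathcomp Require Import complex.
From mathcomp Require Import reals.
Set Implicit Arguments.
Unset Strict Implicit.
Unset Printing Implicit Defensive.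
Import Order.TTheory GRing.Theory Num.Theory.
Local Open Scope ring_scope.
Local Open Scope complex_scope.

Record monpoly (R : realType) (n : nat) := Monpoly {
  monpoly_val :> {poly R[i]};
  _ : (monpoly_val \is monic) && (size monpoly_val == n.+1) }.

HB.instance Definition _ (R : realType) (n : nat) :=
  [isSub for @monpoly_val R n].

Section FiniteFree.
Variable R : realType.
Local Notation C := R[i].

Lemma monpoly_monic n (p : monpoly R n) : (p : {poly C}) \is monic.
Proof. by case: p => p /= /andP[]. Qed.

Lemma size_monpoly n (p : monpoly R n) : size p = n.+1.
Proof. by case: p => p /= /andP[_ /eqP]. Qed.

(* Meaningful for k <= n only: the subtraction n - k is truncated. *)
Definition ecoef n (p : monpoly R n) (k : nat) : C := (-1) ^+ k * p`_(n - k).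

Lemma ecoef0 n (p : monpoly R n) : ecoef p 0 = 1.
Proof.
rewrite /ecoef expr0 mul1r subn0.
by have /monicP := monpoly_monic p; rewrite lead_coefE size_monpoly.
Qed.

Lemma ecoefE n (p : monpoly R n) :
  (p : {poly C}) = \sum_(k < n.+1) ((-1) ^+ k * ecoef p k) *: 'X^(n - k).
Proof.
rewrite -[LHS]coefK size_monpoly poly_def [LHS](reindex_inj rev_ord_inj) /=.
by apply: eq_bigr => k _; rewrite /ecoef subSS signrMK.
Qed.

Definition poly_of_ecoef (n : nat) (e : nat -> C) : {poly C} :=
  \sum_(k < n.+1) ((-1) ^+ k * e k) *: 'X^(n - k).

Lemma coef_poly_of_ecoef n e k : (k <= n)%N ->
  (poly_of_ecoef n e)`_(n - k) = (-1) ^+ k * e k.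
Proof.
move=> lekn; rewrite /poly_of_ecoef coef_sum.
rewrite (bigD1 (Ordinal (lekn : (k < n.+1)%N))) //= coefZ coefXn eqxx mulr1.
rewrite big1 ?addr0 // => j njk; rewrite coefZ coefXn.
suff /negPf-> : (n - k != n - j)%N by rewrite mulr0.
apply: contra njk => /eqP eqkj; apply/eqP/val_inj => /=.
by rewrite -(subKn lekn) eqkj subKn // -ltnS.
Qed.

Lemma poly_of_ecoef_subproof n (e : nat -> C) : e 0%N = 1 ->
  (poly_of_ecoef n e \is monic) && (size (poly_of_ecoef n e) == n.+1).
Proof.
move=> e0; have cn : (poly_of_ecoef n e)`_n = 1.
  by rewrite -{2}[n]subn0 coef_poly_of_ecoef // e0 expr0 mulr1.
have sz : size (poly_of_ecoef n e) = n.+1.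
  apply/eqP; rewrite eqn_leq; apply/andP; split; last first.
    by apply: contraT; rewrite -leqNgt => /leq_sizeP/(_ n (leqnn n)) /eqP; rewrite cn oner_eq0.
  apply: (leq_trans (size_sum _ _ _)); apply/bigmax_leqP => k _.
  by apply: leq_trans (size_scale_leq _ _) _; rewrite size_polyXn ltnS leq_subr.
by rewrite monicE lead_coefE sz /= cn !eqxx.
Qed.

Definition monpoly_of_ecoef n (e : nat -> C) (e0 : e 0%N = 1) : monpoly R n :=
  Monpoly (poly_of_ecoef_subproof n e0).

Lemma ecoef_of_ecoef n (e : nat -> C) (e0 : e 0%N = 1) k : (k <= n)%N ->
  ecoef (monpoly_of_ecoef n e0) k = e k.
Proof. by move=> lekn; rewrite /ecoef coef_poly_of_ecoef // signrMK. Qed.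

Lemma mconv_subproof n (p q : monpoly R n) :
  'C(n, 0)%:R^-1 * ecoef p 0 * ecoef q 0 = 1.
Proof. by rewrite !ecoef0 bin0 invr1 !mulr1. Qed.

Definition mconv n (p q : monpoly R n) : monpoly R n :=
  @monpoly_of_ecoef n (fun k => 'C(n, k)%:R^-1 * ecoef p k * ecoef q k)
    (mconv_subproof p q).

Lemma degree_doubling_subproof m (p : monpoly R m) :
  ((p : {poly C}) \Po 'X^2 \is monic) &&
  (size ((p : {poly C}) \Po 'X^2) == (2 * m).+1).
Proof.
rewrite monicE lead_coef_comp ?size_polyXn // lead_coefXn expr1n mulr1.
rewrite (monicP (monpoly_monic p)) eqxx /=.
have := size_comp_poly (p : {poly C}) 'X^2.
rewrite size_polyXn size_monpoly /= mulnC => <-; rewrite prednK // lt0n size_poly_eq0.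
by rewrite -lead_coef_eq0 lead_coef_comp ?size_polyXn // lead_coefXn expr1n
  mulr1 lead_coef_eq0 monic_neq0 // monpoly_monic.
Qed.

Definition degree_doubling m (p : monpoly R m) : monpoly R (2 * m) :=
  Monpoly (degree_doubling_subproof p).

Lemma even_part_subproof m (p : monpoly R (2 * m)) :
  (-1) ^+ 0 * ecoef p (2 * 0) = 1.
Proof. by rewrite muln0 ecoef0 mulr1. Qed.

(* With these signs, the even-degree part of p is (even_part p) \Po 'X^2. *)
Definition even_part m (p : monpoly R (2 * m)) : monpoly R m :=
  @monpoly_of_ecoef m (fun k => (-1) ^+ k * ecoef p (2 * k))
    (even_part_subproof p).

Definition falling (a : R) (k : nat) : R := \prod_(i < k) (a - i%:R).

Definition hyp_ecoef (n : nat) (bs as_ : seq R) (k : nat) : R :=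
  'C(n, k)%:R * ((\prod_(b <- bs) falling (n%:R * b) k) /
                 (\prod_(a <- as_) falling (n%:R * a) k)).

Lemma hyp_subproof n bs as_ : (hyp_ecoef n bs as_ 0)%:C = 1.
Proof.
rewrite /hyp_ecoef bin0 mul1r !big1 ?divr1 // => x _; exact: big_ord0.
Qed.

(* Total in as_; it is the hypergeometric polynomial when every entry of as_
   is hyp_admissible, so that no denominator vanishes. *)
Definition hyp (n : nat) (bs as_ : seq R) : monpoly R n :=
  @monpoly_of_ecoef n (fun k => (hyp_ecoef n bs as_ k)%:C)
    (hyp_subproof n bs as_).

Definition hyp_admissible (n : nat) (a : R) : Prop :=
  forall i : 'I_n, a <> i%:R / n%:R.

Lemma falling_admissible_neq0 n (a : R) k :
  hyp_admissible n a -> (k <= n)%N -> falling (n%:R * a) k != 0.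
Proof.
move=> ha lekn; rewrite /falling; apply/prodf_neq0 => i _.
have ltin : (i < n)%N by apply: leq_trans (ltn_ord i) lekn.
have n0 : n%:R != 0 :> R by rewrite pnatr_eq0 -lt0n (leq_ltn_trans _ ltin).
rewrite subr_eq0; apply/eqP => e; apply: (ha (Ordinal ltin)) => /=.
by rewrite -e mulrAC divff // mul1r.
Qed.

Lemma hyp_admissible_neg m : hyp_admissible m (- (1 / (2 * m)%:R)).
Proof.
move=> i e; have m0 : (0 < m)%N by apply: leq_ltn_trans (ltn_ord i).
have : (0 : R) <= i%:R / m%:R by rewrite divr_ge0 ?ler0n.
by rewrite -e oppr_ge0 leNgt divr_gt0 ?ltr0n ?muln_gt0 ?m0.
Qed.

Lemma hyp_admissible_sub1 m : hyp_admissible m (1 - 1 / (2 * m)%:R).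
Proof.
move=> i e; have m0 : (0 < m)%N by apply: leq_ltn_trans (ltn_ord i).
have mR : m%:R != 0 :> R by rewrite pnatr_eq0 -lt0n.
have : (2 * m)%:R * (1 - 1 / (2 * m)%:R) = (2 * m)%:R * (i%:R / m%:R) :> R by rewrite e.
rewrite mulrBr mulr1 div1r divff ?natrM ?mulf_neq0 ?pnatr_eq0 //; last by rewrite -lt0n.
rewrite -[RHS]mulrA [m%:R * (_ / _)]mulrC divfK // -!natrM.
move=> /eqP; rewrite subr_eq -(natrD _ _ 1) eqr_nat => /eqP /(congr1 odd).
by rewrite oddD !oddM.
Qed.

End FiniteFree.

Notation "p \boxtimes q" := (mconv p q) (at level 40, left associativity).

(* Main.v *)
Require Import Defs.
From HB Require Import structures.
From mathcomp Require Import all_boot all_order all_algebra.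
From mathcomp Require Import complex.
From mathcomp Require Import reals.
From mathcomp Require Import ring lra zify.
Set Implicit Arguments.
Unset Strict Implicit.
Unset Printing Implicit Defensive.
Import Order.TTheory GRing.Theory Num.Theory.
Local Open Scope ring_scope.

(** A monic polynomial is determined by its coefficients [e_k], so both
    identities are compared coefficient by coefficient.  In the first identity
    both [k]-th coefficients are [e_2k(p) * e_2k(q)] times a factor that does not
    depend on [p] and [q]; in the second, the same holds for both [2k]-th
    coefficients and [e_k(p) * e_k(q)], while the odd coefficients vanish, since
    degree doubling produces even polynomials.  The factors agree because of the
    binomial identity
      [C(2m,2k) * (-1/2)_k = (-1)^k * C(m,k) * (m - 1/2)_k],
    where [(a)_k] is the falling factorial ([bin_double_falling]).  It turns the
    [k]-th coefficients of the two hypergeometric polynomials into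
    [(-1)^k * C(m,k)^2 / C(2m,2k)] and [C(2m,2k)^2 / C(m,k)] respectively
    ([ecoef_hyp_even] and [ecoef_hyp_double]). *)

Section EvenConvolution.
Variable R : realType.

Lemma monpoly_ecoef_inj n (p q : monpoly R n) :
  (forall k, (k <= n)%N -> ecoef p k = ecoef q k) -> p = q.
Proof.
move=> e; apply/val_inj => /=; rewrite [LHS]ecoefE [RHS]ecoefE.
by apply: eq_bigr => k _; rewrite e // -ltnS.
Qed.

Lemma ecoef_mconv n (p q : monpoly R n) k : (k <= n)%N ->
  ecoef (p \boxtimes q) k = 'C(n, k)%:R^-1 * ecoef p k * ecoef q k.
Proof. exact: ecoef_of_ecoef. Qed.

Lemma ecoef_even_part m (p : monpoly R (2 * m)) k : (k <= m)%N ->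
  ecoef (even_part p) k = (-1) ^+ k * ecoef p (2 * k).
Proof. exact: ecoef_of_ecoef. Qed.

Lemma ecoef_degree_doubling m (p : monpoly R m) k : (k <= m)%N ->
  ecoef (degree_doubling p) (2 * k) = (-1) ^+ k * ecoef p k.
Proof.
move=> lekm; rewrite /ecoef /= -mulnBr coef_comp_poly_Xn //.
by rewrite dvdn_mulr // mulKn // exprM sqrrN !expr1n mul1r signrMK.
Qed.

Lemma ecoef_degree_doubling_odd m (p : monpoly R m) k :
  (k <= 2 * m)%N -> odd k -> ecoef (degree_doubling p) k = 0.
Proof.
move=> lek oddk; rewrite /ecoef /= coef_comp_poly_Xn //.
by rewrite dvdn2 oddB // oddM oddk mulr0.
Qed.

Lemma fallingS (a : R) k : falling a k.+1 = falling a k * (a - k%:R).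
Proof. exact: big_ord_recr. Qed.

(** Both sides satisfy the same first-order recurrence in [k], obtained from
    [(k+1) C(n,k+1) = (n-k) C(n,k)], used twice for [n = 2m] and once for
    [n = m], and from [(a)_(k+1) = (a)_k * (a - k)]. *)
Lemma bin_double_falling m k : (k <= m)%N ->
  'C(2 * m, 2 * k)%:R * falling (- (1 / 2) : R) k =
  (-1) ^+ k * 'C(m, k)%:R * falling (m%:R - 1 / 2) k.
Proof.
elim: k => [|k IHk] ltkm; first by rewrite muln0 !bin0 /falling !big_ord0 !mul1r.
have {IHk} IH := IHk (ltnW ltkm).
have e1 : (k%:R + 1) * 'C(m, k.+1)%:R = (m%:R - k%:R) * 'C(m, k)%:R :> R.
  by rewrite natr1 -natrB ?(ltnW ltkm) // -!natrM mul_bin_left.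
have e2 : (2 * k%:R + 1) * 'C(2 * m, (2 * k).+1)%:R =
          (2 * m%:R - 2 * k%:R) * 'C(2 * m, 2 * k)%:R :> R.
  rewrite -!natrM natr1 -natrB; last by lia.
  by rewrite -!natrM mul_bin_left.
have e3 : (2 * k%:R + 2) * 'C(2 * m, 2 * k.+1)%:R =
          (2 * m%:R - 2 * k%:R - 1) * 'C(2 * m, (2 * k).+1)%:R :> R.
  have -> : 2 * k%:R + 2 = (2 * k).+2%:R :> R by rewrite -natrM -natrD addn2.
  have -> : 2 * m%:R - 2 * k%:R - 1 = (2 * m - (2 * k).+1)%:R :> R.
    rewrite natrB; last by lia.
    by rewrite -[in RHS]natr1 !natrM; ring.
  by rewrite -!natrM mulnS mul_bin_left.
(* The common denominator of the three recurrences is cleared first. *)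
have k0 : (0 : R) <= k%:R by exact: ler0n.
have c0 : (2 * k%:R + 1) * (2 * k%:R + 2) != 0 :> R.
  by apply: lt0r_neq0; apply: mulr_gt0; lra.
apply: (mulfI c0); rewrite !fallingS exprS.
set f := falling _ _ in IH *; set g := falling _ _ in IH *.
set s := (-1) ^+ k in IH *.
transitivity (((2 * k%:R + 2) * 'C(2 * m, 2 * k.+1)%:R)
              * ((2 * k%:R + 1) * f * (- (1 / 2) - k%:R))); first by ring.
rewrite e3.
transitivity (((2 * k%:R + 1) * 'C(2 * m, (2 * k).+1)%:R)
              * ((2 * m%:R - 2 * k%:R - 1) * f * (- (1 / 2) - k%:R))); first by ring.
rewrite e2.
transitivity (('C(2 * m, 2 * k)%:R * f) * ((2 * m%:R - 2 * k%:R)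
              * (2 * m%:R - 2 * k%:R - 1) * (- (1 / 2) - k%:R))); first by ring.
rewrite IH.
transitivity (((m%:R - k%:R) * 'C(m, k)%:R) * (s * g * 2
              * (2 * m%:R - 2 * k%:R - 1) * (- (1 / 2) - k%:R))); first by ring.
by rewrite -e1; field.
Qed.

Lemma bin_neq0 (F : numDomainType) n k : (k <= n)%N -> 'C(n, k)%:R != 0 :> F.
Proof. by move=> lekn; rewrite pnatr_eq0 -lt0n bin_gt0. Qed.

(** The arguments are those of the hypergeometric polynomials, [m * b] and [m * a],
    that is [-1/2] and [m - 1/2]. *)
Lemma falling_double_ratio m k : (0 < m)%N -> (k <= m)%N ->
  falling (m%:R * - (1 / (2 * m)%:R) : R) k /
  falling (m%:R * (1 - 1 / (2 * m)%:R)) k =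
  (-1) ^+ k * 'C(m, k)%:R / 'C(2 * m, 2 * k)%:R.
Proof.
move=> m0 lekm; have mR : m%:R != 0 :> R by rewrite pnatr_eq0 -lt0n.
have nz := falling_admissible_neq0 (@hyp_admissible_sub1 R m) lekm.
have le2 : (2 * k <= 2 * m)%N by rewrite leq_mul2l.
have eN : m%:R * - (1 / (2 * m)%:R) = - (1 / 2) :> R by rewrite natrM; field.
have eB : m%:R * (1 - 1 / (2 * m)%:R) = m%:R - 1 / 2 :> R by rewrite natrM; field.
apply/eqP; rewrite eqr_div ?bin_neq0 //; apply/eqP.
by rewrite eN eB mulrC bin_double_falling.
Qed.

(** The hypergeometric factor of the first identity. *)
Lemma ecoef_hyp_even m k : (0 < m)%N -> (k <= m)%N ->
  ecoef (hyp m [:: - (1 / (2 * m)%:R : R)] [:: 1 - 1 / (2 * m)%:R]) k =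
  (-1) ^+ k * 'C(m, k)%:R ^+ 2 / 'C(2 * m, 2 * k)%:R.
Proof.
move=> m0 lekm; rewrite ecoef_of_ecoef // /hyp_ecoef !big_seq1.
rewrite falling_double_ratio // !rmorphM fmorphV rmorphXn rmorphN1 /=.
by rewrite !rmorph_nat; ring.
Qed.

(** The hypergeometric factor of the second identity; its ratio of falling
    factorials is the inverse square of the one in [falling_double_ratio]. *)
Lemma ecoef_hyp_double m k : (0 < m)%N -> (k <= m)%N ->
  ecoef (hyp m [:: 1 - 1 / (2 * m)%:R; 1 - 1 / (2 * m)%:R]
               [:: - (1 / (2 * m)%:R : R); - (1 / (2 * m)%:R)]) k =
  'C(2 * m, 2 * k)%:R ^+ 2 / 'C(m, k)%:R.
Proof.
move=> m0 lekm; rewrite ecoef_of_ecoef // /hyp_ecoef !big_cons !big_nil !mulr1.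
have le2 : (2 * k <= 2 * m)%N by rewrite leq_mul2l.
rewrite -mulf_div -[falling _ k / _]invf_div falling_double_ratio //.
rewrite -invfM !rmorphM !fmorphV !rmorphM !fmorphV !rmorphXn !rmorphN1 /=.
rewrite !rmorph_nat -expr2 !exprMn sqrr_sign mul1r.
have := bin_neq0 R[i] lekm; have := bin_neq0 R[i] le2.
by move=> *; field; apply/andP.
Qed.

End EvenConvolution.

Theorem proposition3p9 (R : realType) (m : nat) (m_ge1 : (1 <= m)%N) :
  (forall p q : monpoly R (2 * m),
     even_part (p \boxtimes q) =
     even_part p \boxtimes even_part q \boxtimes
     hyp m [:: - (1 / (2 * m)%:R)] [:: 1 - 1 / (2 * m)%:R])
  /\
  (forall p q : monpoly R m,
     degree_doubling (p \boxtimes q) =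
     degree_doubling p \boxtimes degree_doubling q \boxtimes
     degree_doubling
       (hyp m [:: 1 - 1 / (2 * m)%:R; 1 - 1 / (2 * m)%:R]
              [:: - (1 / (2 * m)%:R); - (1 / (2 * m)%:R)])).
Proof.
split=> p q; apply: monpoly_ecoef_inj => k lek.
  have le2 : (2 * k <= 2 * m)%N by rewrite leq_mul2l.
  have bm := bin_neq0 R[i] lek; have b2 := bin_neq0 R[i] le2.
  rewrite ecoef_even_part // !ecoef_mconv // !ecoef_even_part //.
  rewrite ecoef_hyp_even //.
  (* The three signs on the right-hand side reduce to one. *)
  transitivity ((-1) ^+ k * ((-1) ^+ k * (-1) ^+ k) *
    ('C(2 * m, 2 * k)%:R^-1 * ecoef p (2 * k) * ecoef q (2 * k))).
    by rewrite -expr2 sqrr_sign mulr1.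
  by field; apply/andP.
rewrite !ecoef_mconv //; case: (boolP (odd k)) => [oddk | evenk].
  by rewrite !ecoef_degree_doubling_odd // mulr0.
have defk : k = (2 * k./2)%N by rewrite mul2n even_halfK.
move: k./2 defk => j defk; move: lek; rewrite {k evenk}defk => le2.
have lej : (j <= m)%N by rewrite leq_mul2l in le2.
have bm := bin_neq0 R[i] lej; have b2 := bin_neq0 R[i] le2.
rewrite !ecoef_degree_doubling // ecoef_mconv // ecoef_hyp_double //.
(* The three degree doublings on the right-hand side contribute one sign each. *)
transitivity ((-1) ^+ j * ((-1) ^+ j * (-1) ^+ j) *
  ('C(m, j)%:R^-1 * ecoef p j * ecoef q j)).
  by rewrite -expr2 sqrr_sign mulr1.
by field; apply/andP.
Qed.
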